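(* Let $F=\{f_1<\cdots<f_k\}$ ($k\ge1$) be a finite set of positive integers and write $F_{\{k\}}=\{f_1,\dots,f_{k-1}\}$. Define the first order differential operators $$A_F=-\frac{\Omega_F(x)}{\Omega_{F_{\{k\}}}(x)}\partial+\frac{\Omega_F'(x)}{\Omega_{F_{\{k\}}}(x)},\qquad B_F=\frac{\Omega_{F_{\{k\}}}(x)}{\Omega_F(x)}\partial-\frac{2x\,\Omega_{F_{\{k\}}}(x)+\Omega_{F_{\{k\}}}'(x)}{\Omega_F(x)} .$$ Then $H_n^F(x)=A_F\big(H_{n-f_k+k}^{F_{\{k\}}}\big)(x)$ for $n\in\sigma_F$. Moreover $$D_{F_{\{k\}}}=B_FA_F+2(f_k+u_{F_{\{k\}}})\,\mathrm{Id},\qquad D_F=A_FB_F+2(f_k+u_F)\,\mathrm{Id}.$$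
   Context: $\partial=d/dx$. Identities between operators are identities of differential operators with rational coefficients. Hermite polynomials: $H_n(x)=n!\sum_{j=0}^{[n/2]}\frac{(-1)^j(2x)^{n-2j}}{j!(n-2j)!}$. For a finite set of positive integers $F=\{f_1<\cdots<f_k\}$: $u_F=\sum_{f\in F}f-\binom{k+1}{2}$; $\sigma_F=\{u_F,u_F+1,\dots\}\setminus\{u_F+f: f\in F\}$; for $n\in\sigma_F$, $H_n^F(x)$ is the $(k+1)\times(k+1)$ determinant whose first row is $(H_{n-u_F}^{(j)}(x))_{j=0}^k$ and whose $(i+1)$-th row is $(H_{f_i}^{(j)}(x))_{j=0}^k$, $i=1,\dots,k$; $\Omega_F(x)=\det\big(H_{f_i}^{(j-1)}(x)\big)_{i,j=1}^k$; and $$D_F=-\partial^2+2\Big(x+\frac{\Omega_F'(x)}{\Omega_F(x)}\Big)\partial+2\Big(k+u_F-x\frac{\Omega_F'(x)}{\Omega_F(x)}\Big)-\frac{\Omega_F''(x)}{\Omega_F(x)} .$$ Conventions for the empty set ($k=0$): $u_\emptyset=0$, $\sigma_\emptyset=\{0,1,2,\dots\}$, $\Omega_\emptyset=1$, $H_n^\emptyset=H_n$, $D_\emptyset=-\partial^2+2x\partial$. *)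

(* Defs.v *)
From HB Require Import structures.
From mathcomp Require Import all_boot all_order all_algebra fraction.
From mathcomp Require Import ring zify.

Set Implicit Arguments.
Unset Strict Implicit.
Unset Printing Implicit Defensive.

Import Order.TTheory GRing.Theory Num.Theory.
Local Open Scope ring_scope.
Local Open Scope quotient_scope.

(* A finite set {f_1 < ... < f_k} of positive integers is its strictly
   increasing enumeration. *)
Definition posint_set (F : seq nat) : bool :=
  sorted ltn F && all (fun f => 0 < f)%N F.

(* The subtraction is never truncated when posint_set F: see bin_le_sumn. *)
Definition u (F : seq nat) : nat := (sumn F - 'C((size F).+1, 2))%N.

Definition sigma (F : seq nat) : pred nat :=
  [pred n | (u F <= n)%N & n \notin [seq (u F + f)%N | f <- F]].

Definition fmax (F : seq nat) : nat := last 0%N F.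

(* F_{k}: F without its largest element. *)
Definition rem_max (F : seq nat) : seq nat := take (size F).-1 F.

Lemma posint_set_rcons F f : posint_set (rcons F f) ->
  posint_set F /\ (size F < f)%N.
Proof.
rewrite /posint_set => /andP[s p].
have sF : sorted ltn F.
  by move: s; rewrite -cats1; case: (F) => //= a G; rewrite cat_path => /andP[].
have pF : all (fun f => 0 < f)%N F by move: p; rewrite all_rcons => /andP[].
rewrite sF pF; split=> //.
elim/last_ind: F f s p sF pF => [|F g IH] f s p sF pF.
  by move: p => /= /andP[].
have sG : sorted ltn F.
  by move: sF; rewrite -cats1; case: (F) => //= a G; rewrite cat_path => /andP[].
have pG : all (fun f => 0 < f)%N F by move: pF; rewrite all_rcons => /andP[].
have lt_gf : (g < f)%N.
  move: s; case: F {IH p sF pF sG pG} => /= [|a G]; first by case/andP.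
  by rewrite rcons_path last_rcons => /andP[].
by rewrite size_rcons; apply: leq_ltn_trans (IH g sF pF sG pG) lt_gf.
Qed.

Lemma bin_le_sumn F : posint_set F -> ('C((size F).+1, 2) <= sumn F)%N.
Proof.
elim/last_ind: F => [|F f IH] // /posint_set_rcons[/IH le lt].
rewrite size_rcons binS bin1 sumn_rcons; lia.
Qed.

Lemma rem_max_rcons F f : rem_max (rcons F f) = F.
Proof. by rewrite /rem_max size_rcons -cats1 take_size_cat. Qed.

Lemma u_rcons F f : posint_set (rcons F f) ->
  (u (rcons F f) + (size F).+1 = u F + f)%N.
Proof.
move=> h; have [/bin_le_sumn le _] := posint_set_rcons h.
move: (bin_le_sumn h).
rewrite /u size_rcons sumn_rcons [in X in (X <= _)%N]binS [in X in (_ - X)%N]binS.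
rewrite bin1; lia.
Qed.

Lemma sigma_rem_max F n : posint_set F -> (0 < size F)%N -> n \in sigma F ->
  (fmax F <= n + size F)%N /\ (n + size F - fmax F)%N \in sigma (rem_max F).
Proof.
case/lastP: F => // F f h _.
have uE := u_rcons h; rewrite !inE /= size_rcons /fmax last_rcons rem_max_rcons.
case/andP=> le nin; split; first lia.
apply/andP; split; first lia.
apply: contra nin => /mapP[g gF e]; apply/mapP; exists g; last lia.
by rewrite mem_rcons inE gF orbT.
Qed.

Section DifferentialOperators.
Variable K : numFieldType.

Local Notation ratfun := {fraction {poly K}}.
Local Notation "p %:F" := (tofrac p) : ring_scope.

(* The derivation (n / d)' = (n' d - n d') / d ^ 2 of K(x), computed on a
   representative; it does not depend on the representative by dfracE. *)
Definition dfrac (f : ratfun) : ratfun :=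
  let: (n, d) := frac (repr f) in
  (n^`() * d - n * d^`())%:F / (d ^+ 2)%:F.

Lemma fracP (f : ratfun) : exists n d : {poly K},
  [/\ d != 0, f = n%:F / d%:F &
      dfrac f = (n^`() * d - n * d^`())%:F / (d ^+ 2)%:F].
Proof.
have := denom_ratioP (repr f); rewrite /dfrac.
have: f * (\d_(repr f))%:F = (\n_(repr f))%:F.
  rewrite -[X in X * _]reprK; move: (repr f) => r.
  have d0 := denom_ratioP r.
  unlock tofrac; rewrite -[LHS]pi_mul; apply/eqmodP.
  rewrite /= equivfE /mulf !numden_Ratio ?mulf_neq0 ?oner_neq0 //.
  by rewrite !mulr1 mulrC.
case: (frac (repr f)) => n d /= e d0; exists n, d; split=> //.
by apply: (canRL (mulfK _)); rewrite ?tofrac_eq0.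
Qed.

Lemma dfracE (n d : {poly K}) : d != 0 ->
  dfrac (n%:F / d%:F) = (n^`() * d - n * d^`())%:F / (d ^+ 2)%:F.
Proof.
move=> d0; have [n0 [d1 [d10 e ->]]] := fracP (n%:F / d%:F).
move/eqP: e; rewrite eqr_div ?tofrac_eq0 // -!tofracM tofrac_eq => /eqP e.
have e' : (n * d1)^`() = (n0 * d)^`() by rewrite e.
rewrite !derivM in e'.
apply/eqP; rewrite eqr_div ?tofrac_eq0 ?expf_neq0 // -!tofracM tofrac_eq.
apply/eqP.
have -> : (n0^`() * d1 - n0 * d1^`()) * d ^+ 2 =
   d1 * d * (n0^`() * d + n0 * d^`()) - d1 * d^`() * (n0 * d)
     - d * d1^`() * (n0 * d) by ring.
by rewrite -e' -e; ring.
Qed.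

Lemma dfrac_tofrac (p : {poly K}) : dfrac p%:F = (p^`())%:F.
Proof.
rewrite -[p%:F]divr1 -tofrac1 dfracE ?oner_eq0 //.
by rewrite expr1n tofrac1 divr1 derivC mulr0 subr0 mulr1.
Qed.

Lemma dfracD : {morph dfrac : f g / f + g}.
Proof.
move=> f g; have [n [d [d0 -> ->]]] := fracP f.
have [m [e [e0 -> ->]]] := fracP g.
rewrite addf_div ?tofrac_eq0 // -!tofracM -tofracD dfracE ?mulf_neq0 //.
rewrite addf_div ?tofrac_eq0 ?expf_neq0 // -!tofracM -tofracD exprMn.
by congr (_%:F / _); rewrite !derivE; ring.
Qed.

Lemma dfracM f g : dfrac (f * g) = dfrac f * g + f * dfrac g.
Proof.
have [n [d [d0 -> ->]]] := fracP f.
have [m [e [e0 -> ->]]] := fracP g.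
rewrite mulf_div -!tofracM dfracE ?mulf_neq0 //.
rewrite !mulf_div -!tofracM.
rewrite addf_div ?tofrac_eq0 ?mulf_neq0 ?expf_neq0 // -!tofracM -tofracD.
apply/eqP; rewrite eqr_div ?tofrac_eq0 ?mulf_neq0 ?expf_neq0 ?mulf_neq0 //.
by rewrite -!tofracM tofrac_eq; apply/eqP; rewrite !derivM; ring.
Qed.

Lemma dfrac0 : dfrac 0 = 0.
Proof. by rewrite -tofrac0 dfrac_tofrac deriv0. Qed.

(* Differential operators with coefficients in K(x), in normal form: the
   coefficient of 'X^i is the coefficient of the i-th power of d/dx. The ring
   product of {poly _} is not the composition of operators. *)
Definition diffop := {poly ratfun}.

Definition dapp (P : diffop) (f : ratfun) : ratfun :=
  \sum_(i < size P) P`_i * iter i dfrac f.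

(* d/dx composed with Q, from (d/dx)(a (d/dx)^j) = a' (d/dx)^j + a (d/dx)^(j+1) *)
Definition dleft (Q : diffop) : diffop := map_poly dfrac Q + 'X * Q.

Definition dcomp (P Q : diffop) : diffop :=
  \sum_(i < size P) P`_i *: iter i dleft Q.

Lemma dapp_wide n (P : diffop) f : (size P <= n)%N ->
  dapp P f = \sum_(i < n) P`_i * iter i dfrac f.
Proof.
move=> le; rewrite /dapp (big_ord_widen n (fun i => P`_i * iter i dfrac f)) //.
rewrite big_mkcond; apply: eq_bigr => i _; case: ltnP => // h.
by rewrite nth_default // mul0r.
Qed.

Lemma dappD P Q f : dapp (P + Q) f = dapp P f + dapp Q f.
Proof.
rewrite (@dapp_wide (maxn (size P) (size Q)) (P + Q)) ?size_polyD //.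
rewrite (@dapp_wide (maxn (size P) (size Q)) P) ?leq_maxl //.
rewrite (@dapp_wide (maxn (size P) (size Q)) Q) ?leq_maxr //.
by rewrite -big_split; apply: eq_bigr => i _; rewrite coefD mulrDl.
Qed.

Lemma dappZ c P f : dapp (c *: P) f = c * dapp P f.
Proof.
rewrite (@dapp_wide (size P) (c *: P)) ?size_scale_leq // big_distrr /=.
by apply: eq_bigr => i _; rewrite coefZ mulrA.
Qed.

Lemma dapp_dleft Q f : dapp (dleft Q) f = dfrac (dapp Q f).
Proof.
have dsum n (E : 'I_n -> ratfun) :
  dfrac (\sum_(i < n) E i) = \sum_(i < n) dfrac (E i).
  by apply: (big_morph dfrac dfracD dfrac0).
rewrite dappD [X in _ = dfrac X]/dapp dsum.
rewrite (@dapp_wide (size Q)) ?size_poly //.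
rewrite (@dapp_wide (size Q).+1 ('X * Q)); last first.
  by rewrite (leq_trans (size_polyMleq _ _)) // size_polyX.
rewrite big_ord_recl coefXM mul0r add0r -big_split; apply: eq_bigr => i _.
by rewrite coef_map_id0 ?dfrac0 // coefXM /= dfracM.
Qed.

Lemma dapp_dcomp P Q f : dapp (dcomp P Q) f = dapp P (dapp Q f).
Proof.
rewrite /dcomp [RHS]/dapp.
rewrite (big_morph (dapp^~ f) (fun A B => dappD A B f) (_ : dapp 0 f = 0)).
  apply: eq_bigr => i _; rewrite dappZ; congr (_ * _).
  by elim: (val i) => //= j <-; rewrite dapp_dleft.
by rewrite /dapp size_poly0 big_ord0.
Qed.

End DifferentialOperators.

Section ExceptionalHermite.
Variable K : numFieldType.

Local Notation "p %:F" := (tofrac p) : ring_scope.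
Local Notation x := ('X : {poly K})%:F.
Local Notation dx := ('X : diffop K).

Definition hermite (n : nat) : {poly K} :=
  n`!%:R *: \sum_(j < n./2.+1)
    ((-1) ^+ j / (j`! * (n - 2 * j)`!)%N%:R) *: (2%:R *: 'X) ^+ (n - 2 * j)%N.

(* Wronskian of the Hermite polynomials of degrees s_0, s_1, ...; it is 1 when
   s is empty. *)
Definition hermite_wronskian (s : seq nat) : {poly K} :=
  \det (\matrix_(i < size s, j < size s) (hermite (nth 0%N s i))^`(j)).

Definition Omega (F : seq nat) : {poly K} := hermite_wronskian F.

(* H_n^F, meaningful for n \in sigma F. *)
Definition xhermite (F : seq nat) (n : nat) : {poly K} :=
  hermite_wronskian ((n - u F)%N :: F).

Definition opD (F : seq nat) : diffop K :=
  let W := (Omega F)%:F in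
  let W' := (Omega F)^`()%:F in
  let W'' := (Omega F)^`(2)%:F in
  - dx ^+ 2 + (2%:R * (x + W' / W)) *: dx
  + (2%:R * ((size F + u F)%N%:R - x * (W' / W)) - W'' / W)%:P.

Definition opA (F : seq nat) : diffop K :=
  let W := (Omega F)%:F in
  let W' := (Omega F)^`()%:F in
  let V := (Omega (rem_max F))%:F in
  (- (W / V)) *: dx + (W' / V)%:P.

Definition opB (F : seq nat) : diffop K :=
  let W := (Omega F)%:F in
  let V := (Omega (rem_max F))%:F in
  let V' := (Omega (rem_max F))^`()%:F in
  (V / W) *: dx - ((2%:R * x * V + V') / W)%:P.

End ExceptionalHermite.

(* Main.v *)
(* Write V = Omega_G and W = Omega_F, where F = G + {f} and m = #|G|. Comparing
   coefficients, each of the two factorizations amounts to the one bilinear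
   equation
     V'' W + W'' V - 2 V' W' + 2 x (V' W - V W') + 2 (f - m) V W = 0,
   which is proved by induction on G. If Y = Wr(G, q) and Z = Wr(G, f, q), then
   V Z = W Y' - W' Y, and combining the equations for (V, W) and (V, Y) gives
     V Z' = V' Z + 2 x V Z + 2 (f - q) W Y.
   This shows both that Z is nonzero when W and Y are and f != q, and, after one
   more differentiation, that (W, Z) satisfies its bilinear equation. The case
   G = {} is the Hermite equation. The relation V Z = W Y' - W' Y is also the
   formula H_n^F = A_F(H_{n-f+k}^G), up to the sign of a cyclic permutation of
   rows. *)
Require Import Defs.
From mathcomp Require Import all_boot all_order all_algebra fraction.
From mathcomp Require Import ring zify.
Import GRing.Theory Num.Theory.
Local Open Scope ring_scope.

Section Wronskian.
Variable R : idomainType.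
Implicit Types (s : seq {poly R}) (p f : {poly R}).

Definition wronskian s : {poly R} :=
  \det (\matrix_(i < size s, j < size s) (s`_i)^`(j)).

Definition wronskian_minor s (j : nat) : {poly R} :=
  \det (\matrix_(i < size s, k < size s) (s`_i)^`(bump j k)).

Lemma wronskianE n s : size s = n ->
  wronskian s = \det (\matrix_(i < n, j < n) (s`_i)^`(j)).
Proof. by case: n /. Qed.

Lemma wronskian_minor_size s : wronskian_minor s (size s) = wronskian s.
Proof.
congr (\det _); apply/matrixP => i j.
by rewrite !mxE /bump leqNgt ltn_ord.
Qed.

Lemma wronskian_rcons s p : wronskian (rcons s p) =
  \sum_(j < (size s).+1)
    p^`(j) * ((-1) ^+ (size s + j) * wronskian_minor s j).
Proof.
rewrite (wronskianE _ _ (size_rcons s p)) (expand_det_row _ ord_max).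
apply: eq_bigr => j _; rewrite mxE nth_rcons ltnn eqxx.
congr (_ * (_ * \det _)); apply/matrixP => i k.
by rewrite !mxE lift_max nth_rcons ltn_ord.
Qed.

Lemma wronskian_cons s p :
  wronskian (p :: s) = (-1) ^+ size s * wronskian (rcons s p).
Proof.
rewrite wronskian_rcons big_distrr /wronskian (expand_det_row _ ord0).
apply: eq_bigr => j _; rewrite mxE /= [RHS]mulrCA; congr (_ * _).
rewrite /cofactor mulrA -exprD addnA addnn -muln2 [in RHS]exprD exprM.
rewrite sqrr_sign mul1r; congr (_ * \det _).
by apply/matrixP => i k; rewrite !mxE.
Qed.

Lemma wronskian_non_uniq s : ~~ uniq s -> wronskian s = 0.
Proof.
move/(uniqPn 0) => [i [j [lt_ij lt_js eq_ij]]].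
have lt_is := ltn_trans lt_ij lt_js.
apply: (@determinant_alternate _ _ _ (Ordinal lt_is) (Ordinal lt_js)).
  by rewrite -val_eqE /= ltn_eqF.
by move=> k; rewrite !mxE /= eq_ij.
Qed.

Lemma wronskian_annihilator s (c : nat -> {poly R}) : wronskian s != 0 ->
  (forall p, p \in s -> \sum_(j < size s) c j * p^`(j) = 0) ->
  forall j, (j < size s)%N -> c j = 0.
Proof.
move=> s_neq0 c_s j lt_j.
have := s_neq0; rewrite /wronskian -det_tr.
case: det0P => // no_ker _; apply/eqP/negP => /negP cj.
case: no_ker; exists (\row_(i < size s) c i).
  by apply: contra cj => /eqP/rowP/(_ (Ordinal lt_j)); rewrite !mxE => ->.
apply/rowP => i; rewrite !mxE -[RHS](c_s s`_i) ?mem_nth //.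
by apply: eq_bigr => k _; rewrite !mxE.
Qed.

(* As functions of p, both sides are differential operators of order
   size s + 1 with leading coefficient [wronskian s * wronskian (rcons s f)],
   and both kill the size s + 1 elements of [rcons s f]. *)
Lemma wronskian_rcons2 s f p : wronskian (rcons s f) != 0 ->
  wronskian s * wronskian (rcons (rcons s f) p) =
  wronskian (rcons s f) * (wronskian (rcons s p))^`()
    - (wronskian (rcons s f))^`() * wronskian (rcons s p).
Proof.
set m := size s; set W := wronskian (rcons s f) => W_neq0.
pose c j := if (j < m.+1)%N then
  (-1) ^+ (m + j) * wronskian_minor s j else 0.
pose c1 j := if j is i.+1 then c i else 0.
pose e j := (-1) ^+ (m.+1 + j) * wronskian_minor (rcons s f) j.
pose d j := wronskian s * e j - W * ((c j)^`() + c1 j) + W^`() * c j.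
have Ec q : wronskian (rcons s q) = \sum_(j < m.+2) c j * q^`(j).
  rewrite big_ord_recr /= {2}/c ltnn mul0r addr0 wronskian_rcons.
  by apply: eq_bigr => j _; rewrite /c ltn_ord mulrC.
have Edc q : (wronskian (rcons s q))^`() =
    \sum_(j < m.+2) ((c j)^`() + c1 j) * q^`(j).
  rewrite Ec linear_sum; under [RHS]eq_bigr do rewrite mulrDl.
  rewrite big_split /= [X in _ = _ + X]big_ord_recl mul0r add0r.
  under eq_bigr do rewrite derivM -derivnS.
  rewrite big_split /=; congr (_ + _).
  by rewrite big_ord_recr /= {2}/c ltnn mul0r addr0.
have Ee q : wronskian (rcons (rcons s f) q) = \sum_(j < m.+2) e j * q^`(j).
  rewrite wronskian_rcons size_rcons.
  by apply: eq_bigr => j _; rewrite /e mulrC.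
have Ed q : wronskian s * wronskian (rcons (rcons s f) q)
    - W * (wronskian (rcons s q))^`() + W^`() * wronskian (rcons s q) =
    \sum_(j < m.+2) d j * q^`(j).
  rewrite Edc Ec Ee !big_distrr -sumrB -big_split /=.
  by apply: eq_bigr => j _; rewrite /d; ring.
have e_top : e m.+1 = W.
  rewrite /e -(size_rcons s f) wronskian_minor_size addnn -muln2 exprM.
  by rewrite sqrr_sign mul1r.
have c_top : c m = wronskian s.
  by rewrite /c ltnSn wronskian_minor_size addnn -muln2 exprM sqrr_sign mul1r.
have d_top : d m.+1 = 0.
  by rewrite /d e_top /c1 c_top {1 2}/c ltnn deriv0; ring.
have d0 j : (j < m.+1)%N -> d j = 0.
  rewrite -(size_rcons s f) => lt_j; apply: wronskian_annihilator lt_j => // q.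
  move=> q_sf; rewrite size_rcons.
  have := Ed q; rewrite big_ord_recr /= d_top mul0r addr0 => <-.
  rewrite [wronskian (rcons (rcons _ _) _)]wronskian_non_uniq; last first.
    by rewrite rcons_uniq q_sf.
  move: q_sf; rewrite mem_rcons inE => /predU1P[->|q_s].
    by rewrite -/W; ring.
  rewrite [wronskian (rcons s q)]wronskian_non_uniq ?rcons_uniq ?q_s //.
  by rewrite deriv0; ring.
have := Ed p; rewrite big1 => [/eqP|j _].
  by rewrite -addrA addr_eq0 opprD opprK -/W => /eqP ->; ring.
have [->|j_neq] := eqVneq (j : nat) m.+1; first by rewrite d_top mul0r.
by rewrite d0 ?mul0r // ltn_neqAle j_neq -ltnS ltn_ord.
Qed.

End Wronskian.

Section BilinearEquation.
Variable R : idomainType.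
Implicit Types (V W Y Z a b : {poly R}).

Definition bilinear_expr a V W : {poly R} :=
  V^`()^`() * W + W^`()^`() * V - 2%:R * V^`() * W^`()
    + 2%:R * 'X * (V^`() * W - V * W^`()) + 2%:R * a * V * W.

Lemma bilinear_darboux a b V W Y Z : V != 0 ->
  bilinear_expr a V W = 0 -> bilinear_expr b V Y = 0 ->
  V * Z = W * Y^`() - W^`() * Y ->
  V * Z^`() = V^`() * Z + 2%:R * 'X * V * Z + 2%:R * (a - b) * W * Y.
Proof.
move=> V_neq0 eqW eqY defZ; apply/subr0_eq/(mulfI V_neq0); rewrite mulr0.
have := congr1 deriv defZ; rewrite derivB !derivM => /eqP.
rewrite -subr_eq0 => /eqP ddefZ; move/eqP: defZ; rewrite -subr_eq0 => /eqP defZ.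
transitivity (W * bilinear_expr b V Y - Y * bilinear_expr a V W
  + V * (V^`() * Z + V * Z^`() - (W^`() * Y^`() + W * Y^`()^`()
    - (W^`()^`() * Y + W^`() * Y^`())))
  - (2%:R * V^`() + 2%:R * 'X * V) * (V * Z - (W * Y^`() - W^`() * Y))).
  by rewrite /bilinear_expr; ring.
by rewrite eqW eqY defZ ddefZ; ring.
Qed.

Lemma bilinear_darboux_eq0 a b V W Y Z : V != 0 ->
  bilinear_expr a V W = 0 -> bilinear_expr b V Y = 0 ->
  V * Z = W * Y^`() - W^`() * Y -> a^`() = 0 -> b^`() = 0 ->
  bilinear_expr (b - 1) W Z = 0.
Proof.
move=> V_neq0 eqW eqY defZ a'0 b'0; apply: (mulfI V_neq0); rewrite mulr0.
have dZ := bilinear_darboux _ _ _ _ _ _ V_neq0 eqW eqY defZ.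
have ddZ : V^`() * Z^`() + V * Z^`()^`() = V^`()^`() * Z + V^`() * Z^`()
    + 2%:R * (V * Z + 'X * (V^`() * Z + V * Z^`()))
    + 2%:R * (a - b) * (W^`() * Y + W * Y^`()).
  have := congr1 deriv dZ.
  rewrite -[2%:R]polyC_natr !(derivD, derivN, derivM) derivX a'0 b'0 derivC.
  by move=> ->; ring.
move/eqP: dZ; rewrite -subr_eq0 => /eqP dZ.
move/eqP: ddZ; rewrite -subr_eq0 => /eqP ddZ.
move/eqP: defZ; rewrite -subr_eq0 => /eqP defZ.
transitivity (Z * bilinear_expr a V W
  + W * (V^`() * Z^`() + V * Z^`()^`() - (V^`()^`() * Z + V^`() * Z^`()
    + 2%:R * (V * Z + 'X * (V^`() * Z + V * Z^`()))
    + 2%:R * (a - b) * (W^`() * Y + W * Y^`())))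
  - 2%:R * W^`() * (V * Z^`()
    - (V^`() * Z + 2%:R * 'X * V * Z + 2%:R * (a - b) * W * Y))
  - 2%:R * (a - b) * W * (V * Z - (W * Y^`() - W^`() * Y))).
  by rewrite /bilinear_expr; ring.
by rewrite eqW dZ ddZ defZ; ring.
Qed.

End BilinearEquation.

Section HermiteEquation.
Variable K : numFieldType.

(* The summands T_j of H_n satisfy 2 x T_j' = 2 (n - 2 j) T_j and
   T_j'' = - 4 (j + 1) T_(j+1), so the sum telescopes. *)
Lemma hermite_ode n :
  (hermite K n)^`()^`() - 2%:R * 'X * (hermite K n)^`()
    + (2 * n)%:R * hermite K n = 0.
Proof.
pose c j : K := (-1) ^+ j / (j`! * (n - 2 * j)`!)%N%:R * 2%:R ^+ (n - 2 * j).
pose T j : {poly K} := c j *: 'X^(n - 2 * j).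
have -> : hermite K n = n`!%:R *: \sum_(j < n./2.+1) T j.
  by congr (_ *: _); apply: eq_bigr => j _; rewrite /T /c exprZn scalerA.
have XdT j : (j < n./2.+1)%N ->
    2%:R * 'X * (T j)^`() = (2 * n)%:R * T j - (4 * j)%:R * T j.
  move=> lt_j; rewrite /T; have [k def_n] : {k | n = k + 2 * j}%N.
    by exists (n - 2 * j)%N; lia.
  have -> : (n - 2 * j = k)%N by lia.
  rewrite def_n derivZ derivXn -!mul_polyC; case: k {def_n} => [|k] /=.
    by rewrite mulr0n; ring.
  by rewrite exprS; ring.
have ddT j : (j < n./2)%N -> (T j)^`()^`() = - ((4 * j.+1)%:R * T j.+1).
  move=> lt_j; rewrite /T; have [k def_n] : {k | n = k + 2 * j.+1}%N.
    by exists (n - 2 * j.+1)%N; lia.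
  have cE : c j * (k.+2 * k.+1)%:R = - ((4 * j.+1)%:R * c j.+1).
    rewrite /c; have -> : (n - 2 * j = k.+2)%N by lia.
    have -> : (n - 2 * j.+1 = k)%N by lia.
    have fact_neq0 i : i`!%:R != 0 :> K by rewrite pnatr_eq0 -lt0n fact_gt0.
    have S_neq0 i : i.+1%:R != 0 :> K by rewrite pnatr_eq0.
    rewrite !factS !natrM !exprS.
    by field; rewrite -!natrD !nat1r !fact_neq0 !S_neq0.
  have -> : (n - 2 * j = k.+2)%N by lia.
  have -> : (n - 2 * j.+1 = k)%N by lia.
  rewrite !derivZ derivXn derivMn derivXn /= -mulrnA -scaler_nat scalerA.
  by rewrite [(k.+1 * _)%N]mulnC cE scaleNr -scalerA scaler_nat mulr_natl.
have ddT_top : (T n./2)^`()^`() = 0.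
  rewrite /T; have -> : (n - 2 * n./2 = odd n)%N by lia.
  rewrite !derivZ derivXn.
  by case: odd; rewrite /= ?mulr1n ?mulr0n ?expr0 ?derivC ?deriv0 scaler0.
have ddT_sum : \sum_(j < n./2.+1) ((T j)^`()^`() + (4 * j)%:R * T j) = 0.
  rewrite big_split /= big_ord_recr /= ddT_top addr0.
  rewrite [X in _ + X]big_ord_recl muln0 mul0r add0r -big_split big1 //= => j _.
  by rewrite ddT // addNr.
rewrite !derivZ -!scalerAr -scalerBr -scalerDr.
set S := \sum_(j < _) _.
suff -> : S^`()^`() - 2%:R * 'X * S^`() + (2 * n)%:R * S = 0.
  by rewrite scaler0.
rewrite -ddT_sum /S !(linear_sum (deriv (R:=K))) !big_distrr /= -sumrB.
rewrite -big_split; apply: eq_bigr => j _ /=.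
by rewrite XdT //; ring.
Qed.

Lemma hermite_neq0 n : hermite K n != 0.
Proof.
apply/eqP => /(congr1 (fun p : {poly K} => p`_n)); rewrite coef0 coefZ coef_sum.
rewrite big_ord_recl /= big1 => [|j _].
  rewrite coefZ exprZn coefZ coefXn muln0 subn0 eqxx mulr1 expr0 addr0.
  apply/eqP; rewrite !mulf_neq0 ?expf_neq0 ?invr_eq0 ?oner_eq0 ?pnatr_eq0 //.
    by rewrite -lt0n fact_gt0.
  by rewrite -lt0n muln_gt0 !fact_gt0.
rewrite coefZ exprZn coefZ coefXn; case: eqP => [e|_]; last by rewrite !mulr0.
by have := ltn_ord j; move: e; rewrite /bump /=; lia.
Qed.

End HermiteEquation.

Section LinearPolynomials.
Variable R : nzRingType.
Implicit Types a b : R.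

Lemma size_ZXaddC_leq a b : (size (a *: 'X + b%:P)%R <= 2)%N.
Proof.
rewrite (leq_trans (size_polyD _ _)) // geq_max.
rewrite (leq_trans (size_scale_leq _ _)) ?size_polyX //=.
by rewrite (leq_trans (size_polyC_leq1 _)).
Qed.

Lemma coef_ZXaddC a b i :
  (a *: 'X + b%:P)`_i = if i is j.+1 then (if j is 0 then a else 0) else b.
Proof.
rewrite coefD coefZ coefX coefC.
by case: i => [|[|i]]; rewrite ?mulr0 ?mulr1 ?addr0 ?add0r.
Qed.

Lemma map_poly_ZXaddC (h : R -> R) a b : h 0 = 0 ->
  map_poly h (a *: 'X + b%:P) = h a *: 'X + (h b)%:P.
Proof.
move=> h0; apply/polyP => i; rewrite coef_map_id0 // !coef_ZXaddC.
by case: i => [|[]].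
Qed.

End LinearPolynomials.

Lemma ZXaddC_mul (R : comNzRingType) (a b c d c' d' : R) :
  b *: (c *: 'X + d%:P) + a *: (c' *: 'X + d'%:P + 'X * (c *: 'X + d%:P)) =
  (a * c) *: 'X ^+ 2 + (a * (c' + d) + b * c) *: 'X + (a * d' + b * d)%:P.
Proof. by rewrite -!mul_polyC !(polyCD, polyCM); ring. Qed.

Section FirstOrderOperators.
Variable K : numFieldType.
Local Notation ratfun := {fraction {poly K}}.
Local Notation dx := ('X : diffop K).

Lemma dcomp_wide n (P Q : diffop K) : (size P <= n)%N ->
  dcomp P Q = \sum_(i < n) P`_i *: iter i (@dleft K) Q.
Proof.
move=> le; rewrite /dcomp.
rewrite (big_ord_widen n (fun i => P`_i *: iter i (@dleft K) Q)) //.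
rewrite big_mkcond; apply: eq_bigr => i _; case: ltnP => // h.
by rewrite nth_default // scale0r.
Qed.

Lemma dcomp_order1 (a b c d : ratfun) :
  dcomp (a *: dx + b%:P) (c *: dx + d%:P) =
  (a * c) *: dx ^+ 2 + (a * (dfrac c + d) + b * c) *: dx
    + (a * dfrac d + b * d)%:P.
Proof.
rewrite -[RHS]ZXaddC_mul -(@map_poly_ZXaddC _ (@dfrac K)) ?dfrac0 //.
rewrite (dcomp_wide 2) ?size_ZXaddC_leq // !big_ord_recl big_ord0 !coef_ZXaddC.
exact: (congr1 (+%R _) (addr0 _)).
Qed.

Lemma dapp_order1 (a b f : ratfun) :
  dapp (a *: dx + b%:P) f = a * dfrac f + b * f.
Proof.
rewrite (@dapp_wide _ 2) ?size_ZXaddC_leq // !big_ord_recl big_ord0.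
by rewrite !coef_ZXaddC addr0 addrC.
Qed.

End FirstOrderOperators.

Section HermiteWronskians.
Variable K : numFieldType.

Lemma hermite_wronskianE s :
  hermite_wronskian K s = wronskian K [seq hermite K i | i <- s].
Proof.
rewrite (wronskianE _ _ _ (size_map _ _)); congr (\det _).
by apply/matrixP => i j; rewrite !mxE (nth_map 0%N).
Qed.

Lemma hermite_wronskian_rcons2 s f q : hermite_wronskian K (rcons s f) != 0 ->
  hermite_wronskian K s * hermite_wronskian K (rcons (rcons s f) q) =
  hermite_wronskian K (rcons s f) * (hermite_wronskian K (rcons s q))^`()
  - (hermite_wronskian K (rcons s f))^`() * hermite_wronskian K (rcons s q).
Proof. by rewrite !hermite_wronskianE !map_rcons => /wronskian_rcons2. Qed.

Lemma hermite_wronskian_cons s q : hermite_wronskian K (q :: s) =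
  (-1) ^+ size s * hermite_wronskian K (rcons s q).
Proof.
by rewrite !hermite_wronskianE map_cons wronskian_cons size_map map_rcons.
Qed.

Lemma hermite_wronskian_bilinear s : uniq s ->
  hermite_wronskian K s != 0 /\ forall q,
    bilinear_expr K (q%:R - (size s)%:R) (hermite_wronskian K s)
      (hermite_wronskian K (rcons s q)) = 0
    /\ (q \notin s -> hermite_wronskian K (rcons s q) != 0).
Proof.
elim/last_ind: s => [_|s f IHs].
  have wr0 : hermite_wronskian K [::] = 1.
    by rewrite /hermite_wronskian det_mx00.
  rewrite wr0 oner_neq0; split=> // q.
  have -> : hermite_wronskian K (rcons [::] q) = hermite K q.
    by rewrite /hermite_wronskian det_mx11 mxE.
  rewrite hermite_neq0; split=> //.
  rewrite /bilinear_expr derivC deriv0 -[RHS](hermite_ode K q) natrM /=.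
  by rewrite mulr0n; ring.
rewrite rcons_uniq => /andP[f_s /IHs[V_neq0 propV]].
have [eqW /(_ f_s) W_neq0] := propV f; split=> // q.
have [eqY Y_neq0] := propV q.
have defZ := hermite_wronskian_rcons2 s f q W_neq0.
split.
  have -> : q%:R - (size (rcons s f))%:R = q%:R - (size s)%:R - 1 :> {poly K}.
    by rewrite size_rcons -natr1; ring.
  apply: (bilinear_darboux_eq0 _ _ _ _ _ _ _ V_neq0 eqW eqY defZ).
    by rewrite -!polyC_natr -polyCB derivC.
  by rewrite -!polyC_natr -polyCB derivC.
rewrite mem_rcons inE negb_or => /andP[q_neq_f /Y_neq0 {}Y_neq0].
apply/eqP => Z0; have := bilinear_darboux _ _ _ _ _ _ _ V_neq0 eqW eqY defZ.
rewrite Z0 deriv0 !mulr0 !add0r => /esym/eqP.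
have -> : f%:R - (size s)%:R - (q%:R - (size s)%:R)
    = (f%:R - q%:R)%:P :> {poly K}.
  by rewrite polyCB !polyC_natr; ring.
rewrite !mulf_eq0 (negPf W_neq0) (negPf Y_neq0) -[2%:R]polyC_natr !polyC_eq0.
by rewrite pnatr_eq0 subr_eq0 eqr_nat [f == q]eq_sym (negPf q_neq_f).
Qed.

End HermiteWronskians.

(* V1, V2, W1, W2 stand for V', V'', W', W''; coefBA_i and coefAB_i give the
   coefficient of the i-th power of d/dx in B_F A_F and A_F B_F. *)
Section Factorization.
Variable L : fieldType.
Variables x V V1 V2 W W1 W2 f m : L.
Hypotheses (V_neq0 : V != 0) (W_neq0 : W != 0).
Hypothesis eqVW : V2 * W + W2 * V - 2%:R * V1 * W1
  + 2%:R * x * (V1 * W - V * W1) + 2%:R * (f - m) * V * W = 0.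

Lemma V2E : V2 = - (W2 * V - 2%:R * V1 * W1
  + 2%:R * x * (V1 * W - V * W1) + 2%:R * (f - m) * V * W) / W.
Proof.
apply: (canRL (mulfK W_neq0)); apply/eqP; rewrite -subr_eq0 -eqVW.
by apply/eqP; ring.
Qed.

Lemma coefBA0 (g : L) :
  V / W * ((W2 * V - W1 * V1) / V ^+ 2)
    + - ((2%:R * x * V + V1) / W) * (W1 / V)
    + 2%:R * (f + g) = 2%:R * (m + g - x * (V1 / V)) - V2 / V.
Proof.
by rewrite V2E; field; rewrite V_neq0 W_neq0.
Qed.

Lemma coefAB0 (g : L) :
  - (W / V) * - (((2%:R * V + 2%:R * x * V1 + V2) * W
      - (2%:R * x * V + V1) * W1) / W ^+ 2)
   + W1 / V * - ((2%:R * x * V + V1) / W) + 2%:R * (f + g)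
   = 2%:R * (m + 1 + g - x * (W1 / W)) - W2 / W.
Proof.
by rewrite V2E; field; rewrite V_neq0 W_neq0.
Qed.

Lemma coefBA1 : V / W * (- ((W1 * V - W * V1) / V ^+ 2) + W1 / V)
  + - ((2%:R * x * V + V1) / W) * - (W / V) = 2%:R * (x + V1 / V).
Proof. by field; rewrite V_neq0 W_neq0. Qed.

Lemma coefAB1 : - (W / V) *
    ((V1 * W - V * W1) / W ^+ 2 - (2%:R * x * V + V1) / W)
  + W1 / V * (V / W) = 2%:R * (x + W1 / W).
Proof. by field; rewrite V_neq0 W_neq0. Qed.

Lemma coefBA2 : V / W * - (W / V) = -1.
Proof. by field; rewrite V_neq0 W_neq0. Qed.

Lemma coefAB2 : - (W / V) * (V / W) = -1.
Proof. by field; rewrite V_neq0 W_neq0. Qed.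

Lemma coefA (y y1 : L) : V * (- (W / V) * y1 + W1 / V * y) = W1 * y - W * y1.
Proof. by field. Qed.

End Factorization.

Section DarbouxOperators.
Variable K : numFieldType.
Local Notation "p %:F" := (tofrac p) : ring_scope.

Lemma dfrac_div (p q : {poly K}) : q != 0 ->
  dfrac (p%:F / q%:F) = (p^`()%:F * q%:F - p%:F * q^`()%:F) / q%:F ^+ 2.
Proof. by move=> q_neq0; rewrite dfracE // tofracXn tofracB !tofracM. Qed.

Lemma dfracN : {morph @dfrac K : f / - f}.
Proof.
move=> f; apply/eqP; rewrite -addr_eq0 -dfracD addNr.
by rewrite dfrac0.
Qed.

Lemma natr_tofrac n : (n%:R : {poly K})%:F = n%:R.
Proof. by rewrite rmorph_nat. Qed.

Lemma bilinear_expr_tofrac (a : {poly K}) V W : bilinear_expr K a V W = 0 ->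
  V^`()^`()%:F * W%:F + W^`()^`()%:F * V%:F - 2%:R * V^`()%:F * W^`()%:F
    + 2%:R * 'X%:F * (V^`()%:F * W%:F - V%:F * W^`()%:F)
    + 2%:R * a%:F * V%:F * W%:F = 0.
Proof.
move/(congr1 (@tofrac _)); rewrite tofrac0 => <-.
by rewrite -!natr_tofrac -!(tofracM, tofracB, tofracD).
Qed.

Lemma dcomp_order1_schrodinger (a b c d e g h : {fraction {poly K}}) :
  a * c = -1 -> a * (dfrac c + d) + b * c = e -> a * dfrac d + b * d + h = g ->
  - 'X ^+ 2 + e *: 'X + g%:P =
  dcomp (a *: 'X + b%:P) (c *: 'X + d%:P) + h%:P :> diffop K.
Proof.
by move=> ac <- <-; rewrite dcomp_order1 ac scaleN1r polyCD [LHS]addrA.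
Qed.

Lemma opD_factorization G f : Omega K G != 0 -> Omega K (rcons G f) != 0 ->
  bilinear_expr K (f%:R - (size G)%:R) (Omega K G) (Omega K (rcons G f)) = 0 ->
  opD K G = dcomp (opB K (rcons G f)) (opA K (rcons G f))
            + (2 * (f + u G))%N%:R%:P
  /\ opD K (rcons G f) = dcomp (opA K (rcons G f)) (opB K (rcons G f))
            + (2 * (f + u (rcons G f)))%N%:R%:P.
Proof.
move=> V_neq0 W_neq0 /bilinear_expr_tofrac.
rewrite /opD /opA /opB rem_max_rcons size_rcons tofracB !natr_tofrac.
rewrite !natrM !natrD.
set V := Omega K G in V_neq0 *; set W := Omega K (rcons G f) in W_neq0 *.
have V'_neq0 : V%:F != 0 by rewrite tofrac_eq0.
have W'_neq0 : W%:F != 0 by rewrite tofrac_eq0.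
set B0 := (2%:R * _ * _ + _) / _.
have <- : (- B0)%:P = - B0%:P :> diffop K by exact: polyCN.
have dA0 : dfrac (W^`()%:F / V%:F) =
  (W^`()^`()%:F * V%:F - W^`()%:F * V^`()%:F) / V%:F ^+ 2 by exact: dfrac_div.
have dA1 : dfrac (- (W%:F / V%:F)) =
  - ((W^`()%:F * V%:F - W%:F * V^`()%:F) / V%:F ^+ 2).
  by rewrite dfracN dfrac_div.
have dB1 : dfrac (V%:F / W%:F) =
  (V^`()%:F * W%:F - V%:F * W^`()%:F) / W%:F ^+ 2 by exact: dfrac_div.
have dB0 : dfrac (- B0) =
  - (((2%:R * V%:F + 2%:R * 'X%:F * V^`()%:F + V^`()^`()%:F) * W%:F
      - (2%:R * 'X%:F * V%:F + V^`()%:F) * W^`()%:F) / W%:F ^+ 2).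
  rewrite dfracN /B0 -natr_tofrac -!tofracM -tofracD dfrac_div //.
  rewrite derivD !derivM derivX -polyC_natr derivC mul0r add0r mulr1 polyC_natr.
  by rewrite !tofracD !tofracM !natr_tofrac.
move=> eqVW; split; apply: dcomp_order1_schrodinger.
- exact (coefBA2 _ _ _ V'_neq0 W'_neq0).
- rewrite dA1; exact (coefBA1 _ _ _ _ _ _ V'_neq0 W'_neq0).
- rewrite dA0; exact (coefBA0 _ _ _ _ _ _ _ _ _ _ V'_neq0 W'_neq0 eqVW _).
- exact (coefAB2 _ _ _ V'_neq0 W'_neq0).
- rewrite dB1; exact (coefAB1 _ _ _ _ _ _ V'_neq0 W'_neq0).
- rewrite dB0 -[(size G).+1%:R]natr1.
  exact (coefAB0 _ _ _ _ _ _ _ _ _ _ V'_neq0 W'_neq0 eqVW _).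
Qed.

Lemma opA_hermite_wronskian G f q :
  Omega K G != 0 -> Omega K (rcons G f) != 0 ->
  dapp (opA K (rcons G f)) (hermite_wronskian K (q :: G))%:F =
  (hermite_wronskian K (q :: rcons G f))%:F.
Proof.
move=> V_neq0 W_neq0; rewrite dapp_order1 dfrac_tofrac rem_max_rcons.
set W := Omega K (rcons G f) in W_neq0 *; set V := Omega K G in V_neq0 *.
have V'_neq0 : V%:F != 0 by rewrite tofrac_eq0.
apply: (mulfI V'_neq0).
rewrite (coefA _ _ _ _ V'_neq0) -!tofracM -tofracB; congr tofrac.
have defZ : V * hermite_wronskian K (rcons (rcons G f) q) =
    W * (hermite_wronskian K (rcons G q))^`()
    - W^`() * hermite_wronskian K (rcons G q).
  exact: hermite_wronskian_rcons2.
rewrite !hermite_wronskian_cons size_rcons exprS mulN1r mulNr mulrN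
  [V * _]mulrCA defZ.
rewrite -signr_odd; case: odd; rewrite ?expr1 ?expr0 ?mulN1r ?mul1r ?derivN.
  by ring.
by ring.
Qed.

End DarbouxOperators.

Theorem lemma5p2 (K : numFieldType) (F : seq nat)
    (F_set : posint_set F) (k_ge1 : (1 <= size F)%N) :
  [/\ forall n : nat, n \in sigma F ->
        tofrac (xhermite K F n) =
        dapp (opA K F)
          (tofrac (xhermite K (rem_max F) (n + size F - fmax F)%N)),
      opD K (rem_max F) =
        dcomp (opB K F) (opA K F) + (2 * (fmax F + u (rem_max F)))%N%:R%:P
    & opD K F =
        dcomp (opA K F) (opB K F) + (2 * (fmax F + u F))%N%:R%:P].
Proof.
have uniqF : uniq F.
  case/andP: F_set => ltF _.
  by apply: sorted_uniq ltF; [apply: ltn_trans|apply: ltnn].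
have [G [f F_eq]] : exists G f, F = rcons G f.
  by case/lastP: F k_ge1 {F_set uniqF} => // G f _; exists G, f.
move: uniqF; rewrite {}F_eq {F k_ge1} in F_set *.
rewrite rcons_uniq => /andP[f_G uniqG].
have [V_neq0 /(_ f)[eqVW /(_ f_G) W_neq0]] :=
  hermite_wronskian_bilinear K G uniqG.
have [eqDV eqDW] := opD_factorization K G f V_neq0 W_neq0 eqVW.
rewrite rem_max_rcons /fmax last_rcons size_rcons.
split; [move=> n | exact eqDV | exact eqDW].
rewrite !inE => /andP[u_le_n _].
rewrite /xhermite (opA_hermite_wronskian _ _ _ _ V_neq0 W_neq0).
congr (tofrac (hermite_wronskian K (_ :: _))).
have := u_rcons F_set; move: u_le_n; lia.
Qed.
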